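(* Let $q\ge 2$ be a real number and let $n\ge 1$ be an integer. Let $\mathcal{Q}_q$ be the distribution on $\mathbb{N}_0$ with mass function $$p_k=\prod_{i\ge 1,\ i\ \mathrm{odd}}\frac{1}{1+1/q^i}\cdot\frac{1}{q^{k^2}\prod_{i=1}^k(1-1/q^{2i})},\qquad k\in\mathbb{N}_0,$$ and let $\mathcal{Q}_{q,n}$ be the distribution on $\{0,\dots,n\}$ with mass function $$p_{k,n}=\frac{N(n,n-k)}{q^{n^2}},\qquad N(n,r)=q^{\binom r2}\prod_{i=1}^r\frac{q^{2n-2(r-i)}-1}{q^i-(-1)^i}.$$ Then $$\frac{0.07}{q^{n+1}}\le\|\mathcal{Q}_{q,n}-\mathcal{Q}_q\|_{\mathrm{TV}}\le\frac{2.3}{q^{n+1}} .$$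
   Context: $\mathbb{N}_0=\{0,1,2,\dots\}$. Empty products equal $1$. For probability distributions $P_1,P_2$ on a countable set $S$, $\|P_1-P_2\|_{\mathrm{TV}}=\frac12\sum_{s\in S}|P_1(s)-P_2(s)|$; a distribution on $\{0,\dots,n\}$ is regarded as a distribution on $\mathbb{N}_0$. For $q$ an odd prime power, $N(n,r)$ is the number of $n\times n$ Hermitian matrices of rank $r$ with entries in $\mathbb{F}_{q^2}$ (Hermitian with respect to the conjugation of $\mathbb{F}_{q^2}$ over $\mathbb{F}_q$), and there are $q^{n^2}$ Hermitian matrices in total. *)

(* Defs.v *)
From mathcomp Require Import all_boot all_order all_algebra.
From mathcomp Require Import all_classical all_reals all_analysis.

Set Implicit Arguments.
Unset Strict Implicit.
Unset Printing Implicit Defensive.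

Import Order.TTheory GRing.Theory Num.Theory.
Import numFieldNormedType.Exports.

Local Open Scope classical_set_scope.
Local Open Scope ring_scope.

(* Distributions on a countable set enter through their mass functions.  The
   sum is taken in \bar R, so the value is meaningful without summability. *)
Definition tv_dist (R : realType) (S : countType) (P1 P2 : S -> R) : \bar R :=
  ((2^-1)%:E * \esum_(s in [set: S]) `|P1 s - P2 s|%:E)%E.

Definition Q_pmf (R : realType) (q : R) (k : nat) : R :=
  limn (fun m : nat => \prod_(1 <= i < m | odd i) (1 / (1 + 1 / q ^+ i))) *
  (1 / (q ^+ (k ^ 2) * \prod_(1 <= i < k.+1) (1 - 1 / q ^+ (2 * i)))).

(* Only used with r <= n, where the natural-number subtractions in the exponent
   do not truncate.  For q an odd prime power this is the number of n x n
   Hermitian matrices of rank r over the field with q^2 elements. *)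
Definition herm_count (R : realType) (q : R) (n r : nat) : R :=
  q ^+ 'C(r, 2) *
  \prod_(1 <= i < r.+1)
    ((q ^+ (2 * n - 2 * (r - i)) - 1) / (q ^+ i - (-1) ^+ i)).

(* Supported on {0, ..., n}, extended by 0 to all of nat. *)
Definition Qn_pmf (R : realType) (q : R) (n k : nat) : R :=
  if (k <= n)%N then herm_count q n (n - k) / q ^+ (n ^ 2) else 0.

(* Main.v *)
Require Import Defs.
From mathcomp Require Import all_boot all_order all_algebra.
From mathcomp Require Import all_classical all_reals all_analysis.
From mathcomp Require Import ring lra zify.

(** Put x = 1 / q, so 0 < x <= 1/2.  Write c for the infinite product of the
    (1 + x^i)^-1 over odd i, and let E(h) be the product of the 1 - x^(2j) for
    1 <= j <= h.  After the powers of q are collected, both mass functions have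
    the same leading factor ([Q_pmfE], [Qn_pmfE]): with m = n - k,

      p_k     = x^(k^2) / E(k) * c,
      p_{k,n} = x^(k^2) / E(k) * d(m) * (E(n) / E(floor(m/2))),

    where d(m) is the part of the product c with i <= m.  The two laws thus
    differ only through c / d(m) and E(n) / E(floor(m/2)).  The first is a product
    over odd indices above m, the second over even indices above m, and each is
    within a geometric tail of 1 ([prod_tail_bounds]).

    Upper bound: as E(k) >= 2/3 and each tail is at most (4/3) x^(m+1), the masses
    at k differ by at most 2 x^(n+1) x^(k(k-1)).  Summing over k
    ([sum_oblong_powers]) and halving gives 34/15 < 2.3.

    Lower bound: the mass at 0 suffices.  There m = n, and the index n + 1
    occurs in exactly one of the two tails, where it dominates everything after
    it, so the masses at 0 differ by at least c x^(n+1) / 4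
    ([mass_gap_zero]), and c >= 0.56. *)

Import Order.TTheory GRing.Theory Num.Theory.
Import numFieldNormedType.Exports.

Local Open Scope ring_scope.

(** * Partial products of the common normalisation *)

(** The inverses sit inside the product so that every factor lies in (0, 1],
    as it does in [even_prod]: one tail estimate then covers both. *)
Definition odd_prod {R : realType} (x : R) (h : nat) : R :=
  \prod_(0 <= j < h) (1 + x ^+ (2 * j).+1)^-1.

Definition even_prod {R : realType} (x : R) (h : nat) : R :=
  \prod_(0 <= j < h) (1 - x ^+ (2 * j).+2).

Lemma expr_bounds {R : realType} {x : R} n :
  0 < x <= 1 / 2 -> 0 < x ^+ n <= 1.
Proof.
move=> hx; rewrite exprn_gt0 ?exprn_ile1 //; lra.
Qed.

Lemma expr_antimono {R : realType} {x : R} {n m} :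
  0 < x <= 1 / 2 -> (m <= n)%N -> x ^+ n <= x ^+ m.
Proof. by move=> hx hmn; apply: ler_wiXn2l => //; lra. Qed.

Lemma expr_le_pow {R : realType} {x : R} {n m} :
  0 < x <= 1 / 2 -> (m <= n)%N -> x ^+ n <= (1 / 2) ^+ m.
Proof.
move=> hx hmn; apply: (le_trans (expr_antimono hx hmn)).
by apply: lerXn2r; rewrite ?nnegrE; lra.
Qed.

(** The defects 1 - g j are dominated by a geometric sequence of ratio x^2, and
    1 - \prod g <= \sum (1 - g).  Since x <= 1/2, the constant 1 / (1 - x^2) is
    at most 4/3. *)
Lemma prod_tail_bounds {R : realType} {x a : R} {g : nat -> R} {h H} :
  0 < x <= 1 / 2 -> 0 <= a ->
  (forall j, 0 <= g j <= 1) -> (forall j, 1 - a * x ^+ (2 * j) <= g j) ->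
  (h <= H)%N ->
  1 - 4 / 3 * (a * x ^+ (2 * h)) <= \prod_(h <= j < H) g j <= 1.
Proof.
move=> hx ha g01 hg hH.
(* Subtracting the finite geometric sum, not the whole series, is what makes
   the claim inductive in H. *)
have main : [/\ 1 - 4 / 3 * (a * (x ^+ (2 * h) - x ^+ (2 * H)))
      <= \prod_(h <= j < H) g j, 0 <= \prod_(h <= j < H) g j
      & \prod_(h <= j < H) g j <= 1].
  elim: H hH => [|H IH] hH.
    have -> : h = 0%N by lia.
    rewrite big_geq //; split; lra.
  have [->|hlt] : h = H.+1 \/ (h <= H)%N by lia.
    by rewrite big_geq //; split; lra.
  have [L P0 P1] := IH hlt.
  rewrite big_nat_recr //=.
  have /andP[g0 g1] := g01 H; have gH := hg H.
  move: (\prod_(h <= j < H) g j) L P0 P1 => P L P0 P1.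
  split; [|exact: mulr_ge0 | by rewrite -[leRHS]mulr1 ler_pM].
  have -> : x ^+ (2 * H.+1) = x ^+ 2 * x ^+ (2 * H) by rewrite -exprD mulnS.
  have /andP[z0 _] := expr_bounds (2 * H)%N hx.
  have x2 : x ^+ 2 <= 1 / 4.
    by have := expr_le_pow hx (leqnn 2); rewrite !expr2; lra.
  set z := x ^+ (2 * H) in gH L z0 *; set w := x ^+ (2 * h) in L *.
  have h1 : P * (1 - a * z) <= P * g H by apply: ler_wpM2l.
  have h2 : P * (a * z) <= a * z by rewrite -[leRHS]mul1r ler_wpM2r // mulr_ge0 // ltW.
  have h3 : x ^+ 2 * (a * z) <= 1 / 4 * (a * z) by rewrite ler_wpM2r // mulr_ge0 // ltW.
  lra.
have [L _ ->] := main; rewrite andbT; apply: le_trans L.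
have : 0 <= a * x ^+ (2 * H) by rewrite mulr_ge0 // exprn_ge0; lra.
lra.
Qed.

Lemma odd_factor_bounds {R : realType} {x : R} n : 0 < x <= 1 / 2 ->
  0 < (1 + x ^+ n)^-1 <= 1 /\ 1 - x ^+ n <= (1 + x ^+ n)^-1.
Proof.
move=> hx; have /andP[z0 z1] := expr_bounds n hx; set z := x ^+ n in z0 z1 *.
split; first by rewrite invr_gt0 invf_le1; lra.
rewrite -[leRHS]mul1r ler_pdivlMr; last lra.
have := mulr_ge0 (ltW z0) (ltW z0); lra.
Qed.

Lemma odd_prod_gt0 {R : realType} {x : R} h : 0 < x <= 1 / 2 -> 0 < odd_prod x h.
Proof.
move=> hx; apply: prodr_gt0 => j _.
by have [/andP[]] := odd_factor_bounds (2 * j).+1%N hx.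
Qed.

Lemma even_prod_gt0 {R : realType} {x : R} h : 0 < x <= 1 / 2 -> 0 < even_prod x h.
Proof.
move=> hx; apply: prodr_gt0 => j _.
have := expr_le_pow hx (_ : 1 <= (2 * j).+2)%N; rewrite expr1 => /(_ isT); lra.
Qed.

Lemma odd_prod_tail {R : realType} {x : R} {h H} : 0 < x <= 1 / 2 -> (h <= H)%N ->
  odd_prod x h * (1 - 4 / 3 * x ^+ (2 * h).+1) <= odd_prod x H <= odd_prod x h.
Proof.
move=> hx hH; have P0 := odd_prod_gt0 h hx.
have : 1 - 4 / 3 * (x * x ^+ (2 * h))
    <= \prod_(h <= j < H) (1 + x ^+ (2 * j).+1)^-1 <= 1.
  apply: prod_tail_bounds => // [|j|j]; first lra.
    by have [/andP[/ltW -> ->]] := odd_factor_bounds (2 * j).+1%N hx.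
  by rewrite -exprS; have [] := odd_factor_bounds (2 * j).+1%N hx.
rewrite [odd_prod x H](big_cat_nat (n := h)) //= -/(odd_prod x h) -exprS.
by move=> /andP[h1 h2]; rewrite ler_pM2l // h1 /= ger_pMr.
Qed.

Lemma even_prod_tail {R : realType} {x : R} {h H} : 0 < x <= 1 / 2 -> (h <= H)%N ->
  even_prod x h * (1 - 4 / 3 * x ^+ (2 * h).+2) <= even_prod x H <= even_prod x h.
Proof.
move=> hx hH; have P0 := even_prod_gt0 h hx.
have : 1 - 4 / 3 * (x ^+ 2 * x ^+ (2 * h))
    <= \prod_(h <= j < H) (1 - x ^+ (2 * j).+2) <= 1.
  apply: prod_tail_bounds => // [|j|j]; first by rewrite exprn_ge0; lra.
    by have /andP[] := expr_bounds (2 * j).+2%N hx; lra.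
  by rewrite -exprD add2n.
rewrite [even_prod x H](big_cat_nat (n := h)) //= -/(even_prod x h) -exprD add2n.
by move=> /andP[h1 h2]; rewrite ler_pM2l // h1 /= ger_pMr.
Qed.

(** Turns the filtered product in the mass function of the limit law into the
    product over j with i = 2j + 1. *)
Lemma big_odd_half {R : realType} (f : nat -> R) m :
  \prod_(1 <= i < m | odd i) f i = \prod_(0 <= j < m./2) f (2 * j).+1.
Proof.
elim: m => [|m IH]; first by rewrite !big_geq.
have [->|m0] := posnP m; first by rewrite !big_geq.
rewrite big_mkcond /= big_nat_recr //= -big_mkcond /= IH uphalf_half.
case: ifP => om; last by rewrite mulr1 add0n.
by rewrite add1n big_nat_recr //=; congr (_ * f _); lia.
Qed.

(** * The infinite product *)

Lemma inv_bounds {R : realType} {q : R} : 2 <= q -> 0 < q^-1 <= 1 / 2.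
Proof. by move=> hq; rewrite invr_gt0 mul1r lef_pV2 ?posrE; lra. Qed.

Definition odd_prod_lim {R : realType} (q : R) : R :=
  limn (fun m : nat => \prod_(1 <= i < m | odd i) (1 / (1 + 1 / q ^+ i))).

(** The tail estimate is uniform in the upper index, so it survives the limit;
    this is the only information on the infinite product that is used. *)
Lemma odd_prod_lim_bounds {R : realType} {q : R} h : 2 <= q ->
  odd_prod q^-1 h * (1 - 4 / 3 * q^-1 ^+ (2 * h).+1) <= odd_prod_lim q
    <= odd_prod q^-1 h.
Proof.
move=> hq.
have hx := inv_bounds hq.
have E m : \prod_(1 <= i < m | odd i) (1 / (1 + 1 / q ^+ i)) = odd_prod q^-1 m./2.
  rewrite big_odd_half; apply: eq_bigr => j _.
  by rewrite !div1r exprVn.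
rewrite /odd_prod_lim (eq_fun E).
have cv : cvgn (fun m => odd_prod q^-1 m./2).
  apply: nonincreasing_is_cvgn.
    by move=> m k hmk; have /andP[] := odd_prod_tail hx (half_leq hmk).
  by exists 0 => _ [m _ <-]; apply/ltW/odd_prod_gt0.
apply/andP; split; [apply: limr_ge => //|apply: limr_le => //]; exists (2 * h)%N => //= m hm;
  have /(odd_prod_tail hx) /andP[] // : (h <= m./2)%N by move: hm => /=; lia.
Qed.

(** * Closed forms of the two mass functions *)

Lemma Q_pmfE {R : realType} (q : R) k :
  Q_pmf q k = q^-1 ^+ (k ^ 2) / even_prod q^-1 k * odd_prod_lim q.
Proof.
rewrite /Q_pmf -/(odd_prod_lim q) mulrC; congr (_ * _).
rewrite div1r invfM exprVn; congr (_ / _).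
rewrite big_add1 /=; apply: eq_bigr => j _.
by rewrite div1r exprVn; congr (1 - (q ^+ _)^-1); lia.
Qed.

(** 1 - (-x)^i is 1 + x^i for odd i and 1 - x^i for even i; among 1, ..., r there
    are uphalf r odd and r./2 even indices. *)
Lemma alternating_prod {R : realType} (x : R) r :
  \prod_(1 <= i < r.+1) (1 - (- x) ^+ i)^-1
  = odd_prod x (uphalf r) / even_prod x r./2.
Proof.
rewrite /odd_prod /even_prod -prodfV.
elim: r => [|r IH]; first by rewrite !big_geq ?mulr1.
rewrite big_nat_recr //= {}IH exprNn.
have [n_odd|n_even] := boolP (odd r).
  have -> : (uphalf r = r./2.+1)%N by lia.
  rewrite [in X in _ = _ * X]big_nat_recr //= !mulrA.
  rewrite -signr_odd /= n_odd expr0 mul1r.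
  by rewrite (_ : (2 * r./2).+2 = r.+1) //; lia.
have -> : (uphalf r = r./2)%N by lia.
rewrite big_nat_recr //= -signr_odd /= n_even expr1 mulN1r opprK.
by rewrite (_ : (2 * r./2).+1 = r.+1) 1?[LHS]mulrAC //; lia.
Qed.

(** With n = k + r and r = n - k, the exponent 2n - 2(r - i) is 2(k + i), free of
    r.  Pulling the powers of q out of the factors leaves the total exponent
    -k^2. *)
Lemma herm_countE {R : realType} (q : R) k r : 2 <= q ->
  herm_count q (k + r) r / q ^+ ((k + r) ^ 2) =
  q^-1 ^+ (k ^ 2) * \prod_(1 <= i < r.+1)
    ((1 - q^-1 ^+ (2 * (k + i))) / (1 - (- q^-1) ^+ i)).
Proof.
move=> hq; have q0 : q != 0 by lra.
rewrite /herm_count.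
have -> : \prod_(1 <= i < r.+1)
    ((q ^+ (2 * (k + r) - 2 * (r - i)) - 1) / (q ^+ i - (-1) ^+ i)) =
  \prod_(1 <= i < r.+1) ((q ^+ (2 * (k + i)) - 1) / (q ^+ i - (-1) ^+ i)).
  by apply: eq_big_nat => i hi; congr ((q ^+ _ - 1) / _); lia.
(* Both sides are now products with factors independent of r, so it suffices
   to compare one factor at a time. *)
elim: r => [|r IH].
  by rewrite !big_geq // addn0 !mulr1 mul1r exprVn.
rewrite [X in _ * X / _]big_nat_recr //= [X in _ = _ * X]big_nat_recr //= [RHS]mulrA -{}IH.
have b : 'C(r.+1, 2) = ('C(r, 2) + r)%N by rewrite binS bin1.
have s : ((k + r.+1) ^ 2 = (k + r) ^ 2 + 2 * (k + r) + 1)%N by nia.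
rewrite b s.
set P := \prod_(_ <= _ < _) _.
have -> : (2 * (k + r.+1) = 2 * (k + r) + 2)%N by lia.
move: P (2 * (k + r))%N ((k + r) ^ 2)%N => P N M.
have D0 : q ^+ r.+1 - (-1) ^+ r.+1 != 0.
  rewrite subr_eq0 -signr_odd; apply/eqP => h.
  have : q ^+ r.+1 >= q by rewrite -[leLHS]expr1 ler_weXn2l //; lra.
  by rewrite h; case: odd; rewrite ?expr1 ?expr0; lra.
have -> : 1 - (- q^-1) ^+ r.+1 = (q ^+ r.+1 - (-1) ^+ r.+1) / q ^+ r.+1.
  by rewrite (exprNn q^-1) exprVn mulrBl divff // expf_neq0.
have -> : 1 - q^-1 ^+ (N + 2) = (q ^+ (N + 2) - 1) / q ^+ (N + 2).
  by rewrite exprVn mulrBl divff ?expf_neq0 // mul1r.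
set D := q ^+ r.+1 - _ in D0 *.
rewrite !exprD (exprS q r) expr1 expr2.
move: (q ^+ N) (q ^+ r) (q ^+ M) (q ^+ 'C(r, 2))
  (expf_neq0 N q0) (expf_neq0 r q0) (expf_neq0 M q0).
move=> A B C E A0 B0 C0; field; rewrite ?A0 ?B0 ?C0 ?D0 ?q0 //.
Qed.

(** The shape of [Q_pmfE], with the infinite product replaced by a finite
    approximation that depends on n - k. *)
Lemma Qn_pmfE {R : realType} (q : R) n k : 2 <= q -> (k <= n)%N ->
  Qn_pmf q n k = q^-1 ^+ (k ^ 2) / even_prod q^-1 k *
    (odd_prod q^-1 (uphalf (n - k)) *
      (even_prod q^-1 n / even_prod q^-1 (n - k)./2)).
Proof.
move=> hq hkn; rewrite /Qn_pmf hkn.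
have [r ->] : exists r, n = (k + r)%N by exists (n - k)%N; rewrite subnKC.
rewrite addKn herm_countE // big_split /= alternating_prod.
have P0 := even_prod_gt0 k (inv_bounds hq).
have -> : \prod_(1 <= i < r.+1) (1 - q^-1 ^+ (2 * (k + i)))
    = even_prod q^-1 (k + r) / even_prod q^-1 k.
  apply: (canRL (mulfK (lt0r_neq0 P0))).
  rewrite mulrC [even_prod q^-1 (k + r)](big_cat_nat (n := k)) ?leq_addr //=.
  congr (_ * _); rewrite -{2}[k]add0n [(k + r)%N]addnC big_addn addnK big_add1 /=.
  by apply: eq_bigr => i _; congr (1 - _ ^+ _); lia.
have D0 := even_prod_gt0 r./2 (inv_bounds hq).
by field; rewrite !lt0r_neq0.
Qed.

(** * The upper bound *)

(** The first odd and the first even index beyond m are m + 1 and m + 2 in some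
    order, so both tails are at most (4/3) x^(m+1).  They push the difference in
    opposite directions, whence the maximum of the two and not their sum. *)
Lemma normalizer_gap {R : realType} {q : R} {m n} : 2 <= q -> (m <= n)%N ->
  `|odd_prod q^-1 (uphalf m) * (even_prod q^-1 n / even_prod q^-1 m./2)
    - odd_prod_lim q| <= 4 / 3 * q^-1 ^+ m.+1.
Proof.
move=> hq hmn; have hx := inv_bounds hq.
have hm : (m./2 <= n)%N by move: hmn; clear; lia.
have wE : q^-1 ^+ (2 * m./2).+2 <= q^-1 ^+ m.+1.
  by apply: (expr_antimono hx); clear; lia.
have wO : q^-1 ^+ (2 * uphalf m).+1 <= q^-1 ^+ m.+1.
  by apply: (expr_antimono hx); clear; lia.
have [pE _] := andP (expr_bounds (2 * m./2).+2 hx).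
have [pO _] := andP (expr_bounds (2 * uphalf m).+1 hx).
have /andP[cl cu] := odd_prod_lim_bounds (uphalf m) hq.
have d0 := odd_prod_gt0 (uphalf m) hx.
have /andP[_ d1] := odd_prod_tail hx (leq0n (uphalf m)).
rewrite {2}/odd_prod big_geq // in d1.
have e0 := even_prod_gt0 m./2 hx.
have /andP[el eu] := even_prod_tail hx hm.
set E := even_prod _ n / _.
have Eu : E <= 1 by rewrite ler_pdivrMr // mul1r.
have El : 1 - 4 / 3 * q^-1 ^+ (2 * m./2).+2 <= E by rewrite ler_pdivlMr // mulrC.
move: E Eu El {e0 el eu hm hmn} => E Eu El.
move: (odd_prod _ _) (odd_prod_lim _) cl cu d0 d1 => d c cl cu d0 d1.
move: (_ ^+ _) wE pE El => tE wE pE El; move: (_ ^+ (_ * uphalf _).+1) wO pO cl => tO wO pO cl.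
move: (_ ^+ _) wE wO => z wE wO {hx hq}.
have h1 : d * (1 - 4 / 3 * tE) <= d * E by rewrite ler_pM2l.
have h2 : d * E <= d * 1 by rewrite ler_pM2l.
have h3 : d * tO <= 1 * z by rewrite ler_pM // ltW.
have h4 : d * tE <= 1 * z by rewrite ler_pM // ltW.
by rewrite ler_distl; lra.
Qed.

Lemma even_prod_inv_le {R : realType} {x : R} k : 0 < x <= 1 / 2 ->
  (even_prod x k)^-1 <= 3 / 2.
Proof.
move=> hx; rewrite -invf_div lef_pV2 ?posrE //; last exact: even_prod_gt0.
have /andP[+ _] := even_prod_tail hx (leq0n k).
rewrite {1}/even_prod big_geq // mul1r muln0; apply: le_trans.
have := expr_le_pow hx (leqnn 2); rewrite [(1 / 2) ^+ 2]expr2; lra.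
Qed.

(** The factor 2 is (3/2) (4/3), from [even_prod_inv_le] and [normalizer_gap].
    The exponents match since k^2 + (n - k) + 1 = (n + 1) + k (k - 1).  For k > n
    only the limit law has mass, and k^2 >= (n + 1) + k (k - 1) makes the same
    bound hold. *)
Lemma mass_gap_upper {R : realType} {q : R} n k : 2 <= q ->
  `|Qn_pmf q n k - Q_pmf q k| <= 2 * q^-1 ^+ n.+1 * q^-1 ^+ (k * k.-1).
Proof.
move=> hq; have hx := inv_bounds hq.
have V0 : 0 <= (even_prod q^-1 k)^-1 by rewrite invr_ge0 ltW // even_prod_gt0.
have V1 := even_prod_inv_le k hx.
have pow_ge0 m : 0 <= q^-1 ^+ m by have /andP[/ltW] := expr_bounds m hx.
rewrite Q_pmfE; have [hkn|hnk] := leqP k n.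
  rewrite Qn_pmfE // -mulrBr normrM ger0_norm; last exact: mulr_ge0.
  apply: (@le_trans _ _ (q^-1 ^+ (k ^ 2) * (3 / 2) * (4 / 3 * q^-1 ^+ (n - k).+1))).
    apply: ler_pM => //; [exact: mulr_ge0 | exact: ler_wpM2l |].
    exact: (normalizer_gap hq (leq_subr k n)).
  have e : q^-1 ^+ (k ^ 2) * q^-1 ^+ (n - k).+1
      = q^-1 ^+ n.+1 * q^-1 ^+ (k * k.-1).
    by rewrite -!exprD; congr (_ ^+ _); move: hkn; clear; case: k => [|j] /= hj; nia.
  by rewrite -[leRHS]mulrA -e le_eqVlt; apply/orP; left; apply/eqP; field.
rewrite /Qn_pmf leqNgt hnk /= sub0r normrN.
have /andP[cl cu] := odd_prod_lim_bounds 0 hq.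
rewrite /odd_prod !big_geq // muln0 expr1 mul1r in cl cu.
have c0 : 0 <= odd_prod_lim q by lra.
rewrite ger0_norm; last by rewrite !mulr_ge0.
apply: (@le_trans _ _ (q^-1 ^+ (k ^ 2) * (3 / 2) * 1)).
  by apply: ler_pM => //; [exact: mulr_ge0 | exact: ler_wpM2l].
have : q^-1 ^+ (k ^ 2) <= q^-1 ^+ n.+1 * q^-1 ^+ (k * k.-1).
  rewrite -exprD; apply: (expr_antimono hx); move: hnk; clear.
  by case: k => [|j] //= hj; nia.
have := pow_ge0 (k ^ 2)%N; lra.
Qed.

(** The exponents 0, 0, 2, 6, 12, ... satisfy (L + 2) (L + 1) >= 2 + 4 L, so from
    the third term on a geometric series of ratio 1/16 dominates:
    1 + 1 + (1/4) / (1 - 1/16) = 34/15. *)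
Lemma sum_oblong_powers {R : realType} {x : R} K : 0 < x <= 1 / 2 ->
  \sum_(0 <= k < K) x ^+ (k * k.-1) <= 34 / 15.
Proof.
move=> hx.
have H L : \sum_(0 <= k < L.+2) x ^+ (k * k.-1)
    <= 34 / 15 - 4 / 15 * (1 / 16) ^+ L.
  elim: L => [|L IH].
    by rewrite !big_nat_recr //= big_geq // muln0 mul1n !expr0; lra.
  rewrite big_nat_recr //= exprS.
  have : x ^+ (L.+2 * L.+1) <= (1 / 2) ^+ (2 + 4 * L) by apply: expr_le_pow => //; nia.
  have -> : (1 / 2 : R) ^+ (2 + 4 * L) = 1 / 4 * (1 / 16) ^+ L.
    by rewrite exprD exprM; congr (_ * _ ^+ _); rewrite !exprS expr0; lra.
  by move: IH; set S := \sum_(_ <= _ < _) _; lra.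
apply: (@le_trans _ _ (\sum_(0 <= k < K.+2) x ^+ (k * k.-1))).
  by rewrite !big_nat_recr //= -addrA lerDl addr_ge0 // exprn_ge0; lra.
apply: (le_trans (H K)).
have : (0 : R) <= (1 / 16) ^+ K by rewrite exprn_ge0; lra.
lra.
Qed.

(** * The lower bound *)

(** The factors i = 1, 3 are kept and the tail from i = 5 on is estimated; the
    worst case x = 1/2 gives (2/3) (8/9) (23/24) = 0.567..., just above the value
    0.56 needed in [mass_gap_zero]. *)
Lemma odd_prod_lim_ge {R : realType} {q : R} : 2 <= q -> 14 / 25 <= odd_prod_lim q.
Proof.
move=> hq; have hx := inv_bounds hq.
have /andP[+ _] := odd_prod_lim_bounds 2 hq; apply: le_trans.
rewrite /odd_prod !big_nat_recr //= big_geq // mul1r muln0 muln1.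
have a1 : 2 / 3 <= (1 + q^-1 ^+ 1)^-1.
  by rewrite expr1 -[leRHS]mul1r ler_pdivlMr; lra.
have a2 : 8 / 9 <= (1 + q^-1 ^+ 3)^-1.
  have := expr_le_pow hx (leqnn 3); have /andP[] := expr_bounds 3 hx.
  rewrite [(1 / 2) ^+ 3]exprS expr2 => h1 h2 h3.
  by rewrite -[leRHS]mul1r ler_pdivlMr; lra.
have a3 : 23 / 24 <= 1 - 4 / 3 * q^-1 ^+ 5.
  have := expr_le_pow hx (leqnn 5).
  by rewrite [(1 / 2) ^+ 5]exprS [(1 / 2) ^+ 4]exprS [(1 / 2) ^+ 3]exprS expr2; lra.
apply: (@le_trans _ _ (2 / 3 * (8 / 9) * (23 / 24))); first lra.
apply: ler_pM => //; last (by apply: ler_pM => //; lra); lra.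
Qed.

(** With y = x^(n+1), the index n + 1 contributes a relative change y to exactly
    one of the two masses at 0, and all later indices contribute at most
    (4/3) x y <= (2/3) y.  Hence the gap survives, with sign given by the parity
    of n. *)
Lemma mass_gap_zero {R : realType} (q : R) n : 2 <= q -> (1 <= n)%N ->
  7 / 50 * q^-1 ^+ n.+1 <= `|Qn_pmf q n 0 - Q_pmf q 0|.
Proof.
move=> hq hn; have hx := inv_bounds hq.
rewrite Q_pmfE Qn_pmfE // -mulrBr subn0.
have := odd_prod_lim_ge hq.
set x := q^-1 in hx *; set c := odd_prod_lim q => c0.
rewrite {1}/even_prod big_geq // invr1 mulr1 expr0 mul1r.
have e0 := even_prod_gt0 n./2 hx.
have d0 := odd_prod_gt0 (uphalf n) hx.
have /andP[y0 _] := expr_bounds n.+1 hx.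
have y_next : x ^+ n.+2 <= 1 / 2 * x ^+ n.+1 by rewrite exprS ler_wpM2r ?(ltW y0) //; lra.
have [n_odd|n_even] := boolP (odd n).
  (* The factor 1 - y belongs to the even product, which has it because
     n + 1 <= 2 n: the finite mass is the smaller one. *)
  have E : even_prod x n / even_prod x n./2 <= 1 - x ^+ n.+1.
    rewrite ler_pdivrMr // mulrC.
    have hm : (n./2.+1 <= n)%N by move: n_odd; clear; lia.
    have /andP[_] := even_prod_tail hx hm.
    by rewrite {2}/even_prod big_nat_recr //= (_ : (2 * n./2).+2 = n.+1) //; lia.
  have /andP[cl cu] := odd_prod_lim_bounds (uphalf n) hq.
  have eO : ((2 * uphalf n).+1 = n.+2)%N by move: n_odd; clear; lia.
  rewrite -/x -/c eO in cl cu.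
  move: cl cu E d0; set d := odd_prod x _; set E := even_prod _ _ / _ => cl cu hE d0.
  have h1 : d * E <= d * (1 - x ^+ n.+1) by rewrite ler_pM2l.
  have h2 : d * x ^+ n.+2 <= d * (1 / 2 * x ^+ n.+1) by rewrite ler_pM2l.
  have h3 : 14 / 25 * x ^+ n.+1 <= d * x ^+ n.+1 by rewrite ler_wpM2r ?(ltW y0) //; lra.
  by rewrite ler_normr; apply/orP; right; lra.
(* The factor 1 / (1 + y) belongs to the infinite product only, so the limit
   mass is the smaller one.  Here n >= 2, hence y <= 1/8, which gives the ratio
   of the masses at least (1 + y) (1 - 2y/3) >= 1 + y/4, and 0.56 / 4 = 0.14. *)
have hm : (n./2 <= n)%N by clear; lia.
have /andP[el _] := even_prod_tail hx hm.
have eE : ((2 * n./2).+2 = n.+2)%N by move: n_even; clear; lia.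
rewrite eE in el.
have El : 1 - 4 / 3 * x ^+ n.+2 <= even_prod x n / even_prod x n./2.
  by rewrite ler_pdivlMr // mulrC.
have /andP[_ cu] := odd_prod_lim_bounds (uphalf n).+1 hq.
rewrite -/x -/c /odd_prod big_nat_recr //= -/(odd_prod x (uphalf n)) in cu.
have eO : ((2 * uphalf n).+1 = n.+1)%N by move: n_even; clear; lia.
rewrite eO in cu.
have hd : c * (1 + x ^+ n.+1) <= odd_prod x (uphalf n).
  by rewrite -ler_pdivlMr //; lra.
have y8 : x ^+ n.+1 <= 1 / 8.
  have n3 : (3 <= n.+1)%N by move: hn n_even; clear; lia.
  by have := expr_le_pow hx n3; rewrite [(1 / 2) ^+ 3]exprS expr2; lra.
move: y_next El hd y0 y8; set y := x ^+ n.+1; set E := even_prod _ _ / _; set d := odd_prod x _.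
move=> y_next El hd y0 y8.
have h1 : c * (1 + y) * (1 - 2 / 3 * y) <= d * E.
  apply: ler_pM => //; [rewrite mulr_ge0; lra|lra|lra].
have h2 : c * (y * y) <= c * (y * (1 / 8)).
  by rewrite ler_wpM2l ?ler_wpM2l; lra.
have h3 : 14 / 25 * y <= c * y by rewrite ler_wpM2r ?(ltW y0).
by rewrite ler_normr; apply/orP; left; lra.
Qed.

(** * Total variation *)

Theorem theorem7p1 (R : realType) (q : R) (n : nat)
    (hq : 2 <= q) (hn : (1 <= n)%N) :
  ((7 / 100 / q ^+ n.+1)%:E <= tv_dist (Qn_pmf q n) (Q_pmf q)
     <= (23 / 10 / q ^+ n.+1)%:E)%E.
Proof.
have hx := inv_bounds hq.
have /andP[/ltW y0 _] := expr_bounds n.+1 hx.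
rewrite /tv_dist -exprVn; apply/andP; split.
  have -> : 7 / 100 * q^-1 ^+ n.+1 = 2^-1 * (7 / 50 * q^-1 ^+ n.+1) by lra.
  rewrite EFinM lee_pmul2l ?lte_fin ?invr_gt0 //.
  (* The mass at 0 alone already accounts for the lower bound. *)
  apply: esum_ge; exists [set 0%N]%classic; first by split.
  by rewrite fsbig_set1 lee_fin mass_gap_zero.
have -> : 23 / 10 * q^-1 ^+ n.+1 = 2^-1 * (23 / 5 * q^-1 ^+ n.+1) by lra.
rewrite EFinM lee_pmul2l ?lte_fin ?invr_gt0 //.
rewrite -nneseries_esumT //.
apply: lime_le; first by apply: is_cvg_nneseries.
apply: nearW => K; rewrite sumEFin lee_fin.
apply: (@le_trans _ _ (\sum_(0 <= k < K)
    2 * q^-1 ^+ n.+1 * q^-1 ^+ (k * k.-1))).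
  by apply: ler_sum => k _; exact: mass_gap_upper.
rewrite -mulr_sumr.
have := ler_wpM2l y0 (sum_oblong_powers K hx); lra.
Qed.
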